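(* Let $(\mathcal{A},\mathcal{B},\mathcal{C})$ be a recollement of abelian categories, with functors $i^{*},i_{*},i^{!},j_{!},j^{*},j_{*}$. If either $i^{!}$ or $i^{*}$ is exact, then $$\max\{\dim\mathcal{A},\dim\mathcal{C}\}\leq\dim\mathcal{B}\leq\dim\mathcal{A}+\dim\mathcal{C}+1.$$
   Context: A recollement $(\mathcal{A},\mathcal{B},\mathcal{C})$ of abelian categories consists of abelian categories $\mathcal{A},\mathcal{B},\mathcal{C}$ and additive functors $i_{*}:\mathcal{A}\to\mathcal{B}$, $i^{*},i^{!}:\mathcal{B}\to\mathcal{A}$, $j^{*}:\mathcal{B}\to\mathcal{C}$, $j_{!},j_{*}:\mathcal{C}\to\mathcal{B}$ such that (1) $(i^{*},i_{*})$, $(i_{*},i^{!})$, $(j_{!},j^{*})$ and $(j^{*},j_{*})$ are adjoint pairs; (2) $i_{*}$, $j_{!}$ and $j_{*}$ are fully faithful; (3) $\mathrm{Im}\,i_{*}=\mathrm{Ker}\,j^{*}$. Extension dimension: let $\mathcal{A}$ be an abelian category. For a class $\mathcal{U}$ of objects, $\mathrm{add}\,\mathcal{U}$ is the full subcategory of direct summands of finite direct sums of objects of $\mathcal{U}$. For subcategories $\mathcal{U}_1,\mathcal{U}_2$, $\mathcal{U}_1\diamond\mathcal{U}_2:=\mathrm{add}\{A\in\mathcal{A}\mid \text{there is an exact sequence } 0\to U_1\to A\to U_2\to 0 \text{ with } U_1\in\mathcal{U}_1, U_2\in\mathcal{U}_2\}$ (an associative operation). For $T\in\mathcal{A}$: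 $\langle T\rangle_0=0$, $\langle T\rangle_1=\mathrm{add}\,T$, $\langle T\rangle_n=\langle T\rangle_1\diamond\langle T\rangle_{n-1}$ for $n\ge 2$. Then $\dim\mathcal{A}:=\inf\{n\ge 0\mid \mathcal{A}=\langle T\rangle_{n+1}\text{ for some }T\in\mathcal{A}\}$ (with $\inf\emptyset=+\infty$). *)

(* Defs.v *)
From HB Require Import structures.
From mathcomp Require Import all_boot all_order all_algebra.
From mathcomp Require Import boolp classical_sets constructive_ereal.

Set Implicit Arguments.
Unset Strict Implicit.
Unset Printing Implicit Defensive.

Import Order.TTheory GRing.Theory Num.Theory.

Local Open Scope classical_set_scope.
Local Open Scope ring_scope.

(* [zmodType] requires a [choiceType] structure on each hom-type; under the
   classical axioms of [boolp] every type carries one, so this is not a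
   restriction. *)
Record preadditive := Preadditive {
  obj :> Type;
  hom : obj -> obj -> zmodType;
  idm : forall X, hom X X;
  comp : forall X Y Z, hom Y Z -> hom X Y -> hom X Z;
  comp_idl : forall X Y (f : hom X Y), comp (idm Y) f = f;
  comp_idr : forall X Y (f : hom X Y), comp f (idm X) = f;
  comp_assoc : forall W X Y Z (h : hom Y Z) (g : hom X Y) (f : hom W X),
    comp h (comp g f) = comp (comp h g) f;
  comp_addl : forall X Y Z (g g' : hom Y Z) (f : hom X Y),
    comp (g + g') f = comp g f + comp g' f;
  comp_addr : forall X Y Z (g : hom Y Z) (f f' : hom X Y),
    comp g (f + f') = comp g f + comp g f'
}.

Arguments idm {p} X.

Notation "g \oc f" := (comp g f) (at level 40, left associativity).

Section Preadditive.
Context {C : preadditive}.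

Definition is_iso (X Y : C) (f : hom X Y) : Prop :=
  exists2 g : hom Y X, g \oc f = idm X & f \oc g = idm Y.

Definition isomorphic (X Y : C) : Prop := exists f : hom X Y, is_iso f.

Definition is_mono (X Y : C) (f : hom X Y) : Prop :=
  forall (W : C) (g h : hom W X), f \oc g = f \oc h -> g = h.

Definition is_epi (X Y : C) (f : hom X Y) : Prop :=
  forall (W : C) (g h : hom Y W), g \oc f = h \oc f -> g = h.

Definition is_zero_object (X : C) : Prop :=
  forall Y : C, (forall f : hom X Y, f = 0) /\ (forall f : hom Y X, f = 0).

Definition is_kernel (K X Y : C) (k : hom K X) (f : hom X Y) : Prop :=
  f \oc k = 0 /\
  forall (W : C) (g : hom W X), f \oc g = 0 -> exists! h : hom W K, k \oc h = g.

Definition is_cokernel (X Y Q : C) (q : hom Y Q) (f : hom X Y) : Prop :=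
  q \oc f = 0 /\
  forall (W : C) (g : hom Y W), g \oc f = 0 -> exists! h : hom Q W, h \oc q = g.

(* Exactness of 0 -> X -> Y -> Z -> 0. *)
Definition short_exact (X Y Z : C) (f : hom X Y) (g : hom Y Z) : Prop :=
  is_kernel f g /\ is_cokernel g f.

Definition is_biproduct (X Y S : C) : Prop :=
  exists (iX : hom X S) (iY : hom Y S) (pX : hom S X) (pY : hom S Y),
    [/\ pX \oc iX = idm X, pY \oc iY = idm Y,
        pX \oc iY = 0, pY \oc iX = 0 &
        iX \oc pX + iY \oc pY = idm S].

Definition is_direct_sum (n : nat) (D : 'I_n -> C) (S : C) : Prop :=
  exists (i : forall k, hom (D k) S) (p : forall k, hom S (D k)),
    [/\ forall k, p k \oc i k = idm (D k),
        forall k l, k != l -> p l \oc i k = 0 &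
        \sum_(k < n) i k \oc p k = idm S].

Definition direct_summand (X Y : C) : Prop := exists X', is_biproduct X X' Y.

Definition is_abelian : Prop :=
  [/\ exists Z : C, is_zero_object Z,
      forall X Y : C, exists S : C, is_biproduct X Y S,
      forall (X Y : C) (f : hom X Y),
        (exists (K : C) (k : hom K X), is_kernel k f) /\
        (exists (Q : C) (q : hom Y Q), is_cokernel q f),
      forall (X Y : C) (f : hom X Y), is_mono f ->
        exists (Z : C) (g : hom Y Z), is_kernel f g &
      forall (X Y : C) (f : hom X Y), is_epi f ->
        exists (W : C) (g : hom W X), is_cokernel f g].

(* Full subcategories are represented by their sets of objects. *)
Definition add (U : set C) : set C := [set X |
  exists (n : nat) (D : 'I_n -> C) (S : C),
    [/\ forall k, U (D k), is_direct_sum D S & direct_summand X S]].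

Definition diamond (U1 U2 : set C) : set C := add [set X |
  exists (X1 X2 : C) (f : hom X1 X) (g : hom X X2),
    [/\ U1 X1, U2 X2 & short_exact f g]].

Fixpoint gen (T : C) (n : nat) : set C :=
  match n with
  | 0 => [set X | is_zero_object X]
  | 1 => add [set T]
  | m.+1 => diamond (add [set T]) (gen T m)
  end.

End Preadditive.

Record abelianCategory := AbelianCategory {
  ab_cat :> preadditive;
  ab_abelian : @is_abelian ab_cat
}.

(* [infimum +oo S] is the greatest lower bound of S, and +oo if S is empty;
   here S is a set of natural numbers embedded in the extended integers. *)
Definition ext_dim (A : abelianCategory) : \bar int :=
  infimum +oo%E [set (n%:Z)%:E | n in
    [set n : nat | exists T : A, gen T n.+1 = [set: A]]].

Record additiveFunctor (C D : preadditive) := AdditiveFunctor {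
  fobj :> C -> D;
  fmap : forall X Y : C, {additive hom X Y -> hom (fobj X) (fobj Y)};
  fmap_id : forall X : C, fmap X X (idm X) = idm (fobj X);
  fmap_comp : forall (X Y Z : C) (g : hom Y Z) (f : hom X Y),
    fmap X Z (g \oc f) = fmap Y Z g \oc fmap X Y f
}.

Arguments fmap {C D} F {X Y} : rename.

Definition fully_faithful (C D : preadditive) (F : additiveFunctor C D) : Prop :=
  forall X Y : C, bijective (fun f : hom X Y => fmap F f).

(* F is left adjoint to G. *)
Definition adjoint_pair (C D : preadditive)
    (F : additiveFunctor C D) (G : additiveFunctor D C) : Prop :=
  exists phi : forall (X : C) (Y : D), hom (F X) Y -> hom X (G Y),
    [/\ forall X Y, bijective (phi X Y),
        forall (X X' : C) (Y : D) (h : hom (F X) Y) (f : hom X' X),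
          phi X' Y (h \oc fmap F f) = phi X Y h \oc f &
        forall (X : C) (Y Y' : D) (g : hom Y Y') (h : hom (F X) Y),
          phi X Y' (g \oc h) = fmap G g \oc phi X Y h].

Definition exact_functor (C D : preadditive) (F : additiveFunctor C D) : Prop :=
  forall (X Y Z : C) (f : hom X Y) (g : hom Y Z),
    short_exact f g -> short_exact (fmap F f) (fmap F g).

(* The image of a functor is closed under isomorphism. *)
Definition functor_image (C D : preadditive) (F : additiveFunctor C D) : set D :=
  [set Y | exists X : C, isomorphic (F X) Y].

Definition functor_kernel (C D : preadditive) (F : additiveFunctor C D) : set C :=
  [set X | is_zero_object (F X)].

Record recollement (A B C : abelianCategory) := Recollement {
  i_lstar : additiveFunctor A B;   (* i_* *)
  i_ustar : additiveFunctor B A;   (* i^* *)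
  i_ushriek : additiveFunctor B A; (* i^! *)
  j_ustar : additiveFunctor B C;   (* j^* *)
  j_lshriek : additiveFunctor C B; (* j_! *)
  j_lstar : additiveFunctor C B;   (* j_* *)
  i_ustar_lstar_adj : adjoint_pair i_ustar i_lstar;
  i_lstar_ushriek_adj : adjoint_pair i_lstar i_ushriek;
  j_lshriek_ustar_adj : adjoint_pair j_lshriek j_ustar;
  j_ustar_lstar_adj : adjoint_pair j_ustar j_lstar;
  i_lstar_ff : fully_faithful i_lstar;
  j_lshriek_ff : fully_faithful j_lshriek;
  j_lstar_ff : fully_faithful j_lstar;
  recollement_im_ker : functor_image i_lstar = functor_kernel j_ustar
}.

(* Main.v *)
Require Import Defs.
From mathcomp Require Import all_boot all_order all_algebra.
From mathcomp Require Import boolp classical_sets constructive_ereal.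
(* Repeated so that [hom] denotes morphisms rather than linear maps. *)
Require Import Defs.

(** The lower bound holds because an exact functor [F : B -> A] hitting every
    object up to isomorphism carries a generator of [B] to a generator of [A]
    without increasing the number of extensions needed
    ([exact_functor_gen], [gen_essentially_surjective]). The functor [j^*] is of
    this kind: it is exact as it has adjoints on both sides, and the counit
    [j^* j_* -> 1] is invertible. So is whichever of [i^!] and [i^*] is exact,
    since [i^! i_*] and [i^* i_*] are isomorphic to the identity.

    For the upper bound, suppose that [i^!] is exact. As [i^! j_* = 0], a
    quotient of [j_* Z] killed by [j^*] is zero ([epi_to_j_lstar]): being killed
    by [j^*], it lies in the image of [i_*], where [i^!] detects objects. Two
    consequences follow: [j_*] is exact, and every [X] in [B] is an extension of
    [j_* j^* X] by an object in the image of [i_*]. If [T] generates [A] in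
    [n + 1] steps and [S] generates [C] in [m + 1] steps, then
    [W = i_* T + j_* S] (direct sum) generates both ends of this sequence, in
    [n + 1] and [m + 1] steps, hence [X] in [n + m + 2] steps
    ([gen_recollement]). The last implication is associativity of the diamond
    product in the form of [gen_extension], and rests on the third isomorphism
    theorem. The case where [i^*] is exact has the sequence
    [0 -> j_! j^* X -> X -> i_* i^* X -> 0] instead; it is obtained from the
    former by passing to opposite categories, under which recollements are
    stable ([op_recollement]). Only the exact sequence and the exactness of
    [j_!] are dualized, because [gen] is not visibly self-dual.

    Membership in [add] is handled through retracts: idempotents split in an
    abelian category, so summands are the same as retracts, and [add U] is the
    least class containing [U] and the zero objects and stable under biproducts
    and retracts ([add_least], [add_additive]). *)

Set Implicit Arguments.
Unset Strict Implicit.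
Unset Printing Implicit Defensive.

Import Order.TTheory GRing.Theory Num.Theory.

(** * Composition, retracts and zero objects *)

Section PreadditiveBasics.
Local Open Scope ring_scope.
Local Open Scope classical_set_scope.
Context {C : preadditive}.
Implicit Types W X Y Z : C.

Lemma comp0m X Y Z (f : hom X Y) : (0 : hom Y Z) \oc f = 0.
Proof. by apply: (addrI (0 \oc f)); rewrite -comp_addl !addr0. Qed.

Lemma compm0 X Y Z (g : hom Y Z) : g \oc (0 : hom X Y) = 0.
Proof. by apply: (addrI (g \oc 0)); rewrite -comp_addr !addr0. Qed.

Lemma compNm X Y Z (g : hom Y Z) (f : hom X Y) : (- g) \oc f = - (g \oc f).
Proof. by apply: (addrI (g \oc f)); rewrite -comp_addl !subrr comp0m. Qed.

Lemma compmN X Y Z (g : hom Y Z) (f : hom X Y) : g \oc (- f) = - (g \oc f).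
Proof. by apply: (addrI (g \oc f)); rewrite -comp_addr !subrr compm0. Qed.

Lemma compBm X Y Z (g h : hom Y Z) (f : hom X Y) :
  (g - h) \oc f = g \oc f - h \oc f.
Proof. by rewrite comp_addl compNm. Qed.

Lemma compmB X Y Z (g : hom Y Z) (f h : hom X Y) :
  g \oc (f - h) = g \oc f - g \oc h.
Proof. by rewrite comp_addr compmN. Qed.

Lemma comp_suml (I : finType) X Y Z (g : I -> hom Y Z) (f : hom X Y) :
  (\sum_i g i) \oc f = \sum_i (g i \oc f).
Proof.
by apply: (big_morph (fun g => g \oc f)) => [a b|]; rewrite ?comp_addl ?comp0m.
Qed.

Lemma comp_sumr (I : finType) X Y Z (g : hom Y Z) (f : I -> hom X Y) :
  g \oc (\sum_i f i) = \sum_i (g \oc f i).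
Proof. by apply: (big_morph (comp g)) => [a b|]; rewrite ?comp_addr ?compm0. Qed.

Lemma mono0 X Y (f : hom X Y) :
  (forall W (g : hom W X), f \oc g = 0 -> g = 0) -> is_mono f.
Proof.
by move=> f0 W g h fgh; apply/subr0_eq/f0; rewrite compmB fgh subrr.
Qed.

Lemma epi0 X Y (f : hom X Y) :
  (forall W (g : hom Y W), g \oc f = 0 -> g = 0) -> is_epi f.
Proof.
by move=> f0 W g h fgh; apply/subr0_eq/f0; rewrite compBm fgh subrr.
Qed.

Lemma mono_eq0 X Y (f : hom X Y) W (g : hom W X) :
  is_mono f -> f \oc g = 0 -> g = 0.
Proof. by move=> mf fg0; apply: mf; rewrite fg0 compm0. Qed.

Lemma epi_eq0 X Y (f : hom X Y) W (g : hom Y W) :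
  is_epi f -> g \oc f = 0 -> g = 0.
Proof. by move=> mf fg0; apply: mf; rewrite fg0 comp0m. Qed.

Lemma kernel_mono K X Y (k : hom K X) (f : hom X Y) : is_kernel k f -> is_mono k.
Proof.
move=> [fk0 kU] W g h kgh.
have [|u [_ uU]] := kU _ (k \oc g); first by rewrite comp_assoc fk0 comp0m.
by rewrite -(uU g) // (uU h).
Qed.

Lemma cokernel_epi X Y Q (q : hom Y Q) (f : hom X Y) :
  is_cokernel q f -> is_epi q.
Proof.
move=> [qf0 qU] W g h gqh.
have [|u [_ uU]] := qU _ (g \oc q); first by rewrite -comp_assoc qf0 compm0.
by rewrite -(uU g) // (uU h).
Qed.

Lemma kernelI K X Y (k : hom K X) (f : hom X Y) :
  f \oc k = 0 -> is_mono k ->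
  (forall W (g : hom W X), f \oc g = 0 -> exists h : hom W K, k \oc h = g) ->
  is_kernel k f.
Proof.
move=> fk0 mk kU; split=> // W g /kU[h khg].
by exists h; split=> // h' kh'; apply: mk; rewrite khg.
Qed.

Lemma cokernelI X Y Q (q : hom Y Q) (f : hom X Y) :
  q \oc f = 0 -> is_epi q ->
  (forall W (g : hom Y W), g \oc f = 0 -> exists h : hom Q W, h \oc q = g) ->
  is_cokernel q f.
Proof.
move=> qf0 eq qU; split=> // W g /qU[h hqg].
by exists h; split=> // h' kh'; apply: eq; rewrite hqg.
Qed.

Lemma epi_comp X Y Z (g : hom Y Z) (f : hom X Y) :
  is_epi g -> is_epi f -> is_epi (g \oc f).
Proof. by move=> eg ef W a b; rewrite !comp_assoc => /ef/eg. Qed.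

Lemma mono_comp X Y Z (g : hom Y Z) (f : hom X Y) :
  is_mono g -> is_mono f -> is_mono (g \oc f).
Proof. by move=> mg mf W a b; rewrite -!comp_assoc => /mg/mf. Qed.

Lemma epi_of_comp X Y Z (g : hom Y Z) (f : hom X Y) :
  is_epi (g \oc f) -> is_epi g.
Proof. by move=> e W a b ab; apply: e; rewrite !comp_assoc ab. Qed.

Lemma iso_epi X Y (f : hom X Y) : is_iso f -> is_epi f.
Proof.
move=> [g _ fg] W a b ab.
by rewrite -(comp_idr a) -(comp_idr b) -fg !comp_assoc ab.
Qed.

Lemma zero_objectP X : is_zero_object X <-> idm X = 0.
Proof.
split=> [X0|X0 Y]; first by have [/(_ (idm X))] := X0 X.
split=> f; first by rewrite -(comp_idr f) X0 compm0.
by rewrite -(comp_idl f) X0 comp0m.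
Qed.

Definition retract X Y := exists (i : hom X Y) (p : hom Y X), p \oc i = idm X.

Lemma retract_refl X : retract X X.
Proof. by exists (idm X), (idm X); rewrite comp_idl. Qed.

Lemma retract_trans Y X Z : retract X Y -> retract Y Z -> retract X Z.
Proof.
move=> [i [p pi]] [j [q qj]]; exists (j \oc i), (p \oc q).
by rewrite -comp_assoc (comp_assoc q) qj comp_idl.
Qed.

Lemma retract_iso X Y : isomorphic X Y -> retract X Y.
Proof. by move=> [f [g gf fg]]; exists f, g. Qed.

Lemma isomorphic_sym X Y : isomorphic X Y -> isomorphic Y X.
Proof. by move=> [f [g gf fg]]; exists g, f. Qed.

Lemma retract_zero X Z : is_zero_object Z -> retract X Z -> is_zero_object X.
Proof.
move=> Z0 [i [p pi]]; apply/zero_objectP.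
by have [_ /(_ i) i0] := Z0 X; rewrite -pi i0 compm0.
Qed.

Lemma zero_retract X Z : is_zero_object Z -> is_zero_object X -> retract X Z.
Proof. by move=> Z0 /zero_objectP X0; exists 0, 0; rewrite compm0. Qed.

Lemma biproduct_retractl X Y S : is_biproduct X Y S -> retract X S.
Proof. by move=> [i [_ [p [_ [pi _ _ _ _]]]]]; exists i, p. Qed.

Lemma direct_summand_retract X Y : direct_summand X Y -> retract X Y.
Proof. by move=> [X' /biproduct_retractl]. Qed.

Lemma biproduct_sym X Y S : is_biproduct X Y S -> is_biproduct Y X S.
Proof.
move=> [iX [iY [pX [pY [H1 H2 H3 H4 H5]]]]].
by exists iY, iX, pY, pX; split=> //; rewrite addrC.
Qed.

Lemma biproduct_zero X Z : is_zero_object Z -> is_biproduct X Z X.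
Proof.
move=> Z0; exists (idm X), 0, (idm X), 0; split; rewrite ?compm0 ?comp0m //.
- by rewrite comp_idl.
- by apply/esym/zero_objectP.
- by rewrite comp_idl addr0.
Qed.

Lemma biproduct_retract X X' Y Y' S T :
  is_biproduct X Y S -> is_biproduct X' Y' T ->
  retract X X' -> retract Y Y' -> retract S T.
Proof.
move=> [iX [iY [pX [pY [_ _ _ _ S1]]]]] [jX [jY [qX [qY [X1 Y1 XY YX _]]]]].
move=> [a [b ba]] [c [d dc]].
exists (jX \oc a \oc pX + jY \oc c \oc pY), (iX \oc b \oc qX + iY \oc d \oc qY).
rewrite comp_addl !comp_addr -S1; congr (_ + _).
  rewrite !comp_assoc -!(comp_assoc _ qX) XY X1 compm0 comp0m comp0m addr0.
  by rewrite comp_idr -(comp_assoc _ b) ba comp_idr.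
rewrite !comp_assoc -!(comp_assoc _ qY) YX Y1 compm0 comp0m comp0m add0r.
by rewrite comp_idr -(comp_assoc _ d) dc comp_idr.
Qed.

(** The classes that occur as values of [gen]. *)
Definition additive_class (U : set C) := [/\
  forall Z, is_zero_object Z -> U Z,
  forall X Y S, is_biproduct X Y S -> U X -> U Y -> U S &
  forall X Y, retract X Y -> U Y -> U X].

End PreadditiveBasics.

(** * Opposite categories *)

Section Opposite.
Local Open Scope ring_scope.
Local Open Scope classical_set_scope.

Definition op (C : preadditive) : preadditive :=
  @Preadditive C (fun X Y => hom Y X) (@idm C) (fun X Y Z g f => f \oc g)
    (fun X Y f => comp_idr f) (fun X Y f => comp_idl f)
    (fun W X Y Z h g f => esym (comp_assoc f g h))
    (fun X Y Z g g' f => comp_addr f g g')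
    (fun X Y Z g f f' => comp_addl f f' g).

Lemma op_isomorphic (C : preadditive) (X Y : C) :
  isomorphic X Y <-> @isomorphic (op C) X Y.
Proof. by split=> [] [f [g gf fg]]; exists g, f. Qed.

Lemma op_zero (C : preadditive) (X : C) :
  is_zero_object X <-> @is_zero_object (op C) X.
Proof. by rewrite !zero_objectP. Qed.

Lemma op_biproduct (C : preadditive) (X Y S : C) :
  is_biproduct X Y S -> @is_biproduct (op C) X Y S.
Proof.
by move=> [iX [iY [pX [pY [? ? ? ? ?]]]]]; exists pX, pY, iX, iY; split.
Qed.

Lemma op_short_exact (C : preadditive) (X Y Z : C) (f : hom X Y) (g : hom Y Z) :
  short_exact f g <-> @short_exact (op C) Z Y X g f.
Proof. by split; case. Qed.

Lemma op_is_abelian (C : preadditive) : @is_abelian C -> @is_abelian (op C).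
Proof.
move=> [[Z Z0] bip kc mk ec]; split.
- by exists Z; apply/op_zero.
- by move=> X Y; have [S /op_biproduct SP] := bip X Y; exists S.
- by move=> X Y f; have [K Q] := kc _ _ f; split; [exact: Q|exact: K].
- by move=> X Y f /ec.
- by move=> X Y f /mk.
Qed.

Definition op_abelian (C : abelianCategory) : abelianCategory :=
  AbelianCategory (op_is_abelian (ab_abelian C)).

Definition op_functor (C D : preadditive) (F : additiveFunctor C D) :
    additiveFunctor (op C) (op D) :=
  @AdditiveFunctor (op C) (op D) F (fun X Y => @fmap C D F Y X)
    (fun X => fmap_id F X) (fun X Y Z g f => fmap_comp F f g).

Lemma op_fully_faithful (C D : preadditive) (F : additiveFunctor C D) :
  fully_faithful F -> fully_faithful (op_functor F).
Proof. by move=> FF X Y; apply: FF. Qed.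

Lemma op_exact_functor (C D : preadditive) (F : additiveFunctor C D) :
  exact_functor F <-> exact_functor (op_functor F).
Proof.
by split=> eF X Y Z f g [kf cg]; have [] := eF _ _ _ g f (conj cg kf).
Qed.

End Opposite.

(** * Adjunctions *)

Section Adjunction.
Local Open Scope ring_scope.
Local Open Scope classical_set_scope.

(** The transposition of an adjoint pair together with its inverse, which
    [adjoint_pair] provides only up to existence. *)
Lemma adjoint_transposes (C D : preadditive) (F : additiveFunctor C D)
    (G : additiveFunctor D C) :
  adjoint_pair F G ->
  exists (phi : forall (X : C) (Y : D), hom (F X) Y -> hom X (G Y))
         (psi : forall (X : C) (Y : D), hom X (G Y) -> hom (F X) Y),
  [/\ forall X Y, cancel (phi X Y) (psi X Y),
      forall X Y, cancel (psi X Y) (phi X Y),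
      forall (X X' : C) (Y : D) (h : hom (F X) Y) (f : hom X' X),
        phi X' Y (h \oc fmap F f) = phi X Y h \oc f &
      forall (X : C) (Y Y' : D) (g : hom Y Y') (h : hom (F X) Y),
        phi X Y' (g \oc h) = fmap G g \oc phi X Y h].
Proof.
move=> [phi [bij nl nr]]; exists phi.
have inv X Y : {g | cancel (phi X Y) g /\ cancel g (phi X Y)}.
  by apply: cid; have [g ? ?] := bij X Y; exists g.
exists (fun X Y => sval (inv X Y)).
by split=> // X Y; have [] := svalP (inv X Y).
Qed.

Lemma op_adjoint (C D : preadditive) (F : additiveFunctor C D)
    (G : additiveFunctor D C) :
  adjoint_pair F G -> adjoint_pair (op_functor G) (op_functor F).
Proof.
move=> /adjoint_transposes[phi [psi [phiK psiK nl nr]]].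
exists (fun (Y : op D) (X : op C) => psi X Y); split.
- by move=> Y X; exists (phi X Y).
- move=> Y Y' X /= h g; apply: (can_inj (phiK _ _)).
  by rewrite psiK nr psiK.
- move=> Y X X' /= f h; apply: (can_inj (phiK _ _)).
  by rewrite psiK nl psiK.
Qed.

(** Composition with [fmap G f] corresponds under transposition to composition
    with [f], so that the two universal properties match. *)
Lemma right_adjoint_kernel (C D : preadditive) (F : additiveFunctor C D)
    (G : additiveFunctor D C) (K X Y : D) (k : hom K X) (f : hom X Y) :
  adjoint_pair F G -> is_kernel k f -> is_kernel (fmap G k) (fmap G f).
Proof.
move=> /adjoint_transposes[phi [psi [phiK psiK nl nr]]] kf.
have mk := kernel_mono kf; have [fk0 kU] := kf.
have phi0 W Z : phi W Z 0 = 0.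
  by have := nr W Z Z 0 0; rewrite compm0 raddf0 comp0m.
apply: kernelI; first by rewrite -fmap_comp fk0 raddf0.
- apply: mono0 => W g kg0; rewrite -(psiK _ _ g) -(phi0 W K); congr (phi _ _ _).
  by apply: (mono_eq0 mk); apply: (can_inj (phiK _ _)); rewrite nr psiK phi0.
- move=> W g fg0; have [|h [kh _]] := kU _ (psi _ _ g).
    by apply: (can_inj (phiK _ _)); rewrite nr psiK phi0.
  by exists (phi _ _ h); rewrite -nr kh psiK.
Qed.

Lemma left_adjoint_cokernel (C D : preadditive) (F : additiveFunctor C D)
    (G : additiveFunctor D C) (X Y Q : C) (q : hom Y Q) (f : hom X Y) :
  adjoint_pair F G -> is_cokernel q f -> is_cokernel (fmap F q) (fmap F f).
Proof.
move=> /op_adjoint FG qf.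
exact: (@right_adjoint_kernel _ _ _ _ _ _ _ (q : @hom (op C) Q Y) f FG qf).
Qed.

Lemma exact_of_adjoints (C D : preadditive) (L : additiveFunctor D C)
    (F : additiveFunctor C D) (G : additiveFunctor D C) :
  adjoint_pair L F -> adjoint_pair F G -> exact_functor F.
Proof.
move=> LF FG X Y Z f g [kf cg]; split; first exact: right_adjoint_kernel LF kf.
exact: left_adjoint_cokernel FG cg.
Qed.

(** The counit of a fully faithful right adjoint [G] is invertible: its inverse
    is the morphism which [G] sends to the unit at [G Y]. *)
Lemma counit_iso (C D : preadditive) (F : additiveFunctor C D)
    (G : additiveFunctor D C) :
  adjoint_pair F G -> fully_faithful G ->
  exists (eta : forall X, hom X (G (F X))) (eps : forall Y, hom (F (G Y)) Y),
  [/\ forall Y, is_iso (eps Y),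
      forall X, is_iso (fmap F (eta X)) &
      forall Y Y' (g : hom Y Y'), g \oc eps Y = eps Y' \oc fmap F (fmap G g)].
Proof.
move=> /adjoint_transposes[phi [psi [phiK psiK nl nr]]] ffG.
pose eta X := phi X (F X) (idm (F X)).
pose eps Y := psi (G Y) Y (idm (G Y)).
have phiE X Y (h : hom (F X) Y) : phi X Y h = fmap G h \oc eta X.
  by rewrite -nr comp_idr.
have epsiso Y : is_iso (eps Y).
  have [r rK Kr] := ffG Y (F (G Y)).
  pose th := r (eta (G Y)); have Gth : fmap G th = eta (G Y) by exact: Kr.
  exists th.
    apply: (can_inj (phiK _ _)).
    by rewrite nr psiK comp_idr Gth.
  have [s sK Ks] := ffG Y Y; apply: (can_inj sK).
  by rewrite fmap_comp Gth -phiE psiK fmap_id.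
exists eta, eps; split=> // [X|Y Y' g].
  have tri : eps (F X) \oc fmap F (eta X) = idm (F X).
    by apply: (can_inj (phiK _ _)); rewrite nl psiK comp_idl.
  have [u ue eu] := epsiso (F X); exists (eps (F X)) => //.
  have <- // : u = fmap F (eta X) by rewrite -[u]comp_idr -tri comp_assoc ue comp_idl.
by apply: (can_inj (phiK _ _)); rewrite nl nr !psiK comp_idl comp_idr.
Qed.

Lemma left_adjoint_essentially_surjective (C D : preadditive)
    (F : additiveFunctor C D) (G : additiveFunctor D C) :
  adjoint_pair F G -> fully_faithful G -> forall Y, exists X, isomorphic (F X) Y.
Proof.
move=> FG ffG Y; have [_ [eps [epsiso _ _]]] := counit_iso FG ffG.
by exists (G Y), (eps Y).
Qed.

Lemma right_adjoint_essentially_surjective (C D : preadditive)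
    (F : additiveFunctor C D) (G : additiveFunctor D C) :
  adjoint_pair F G -> fully_faithful F -> forall X, exists Y, isomorphic (G Y) X.
Proof.
move=> /op_adjoint FG /op_fully_faithful ffF X.
have [Y /op_isomorphic isoY] := left_adjoint_essentially_surjective FG ffF X.
by exists Y; apply: isoY.
Qed.

End Adjunction.

(** * Exact sequences in abelian categories *)

Section Abelian.
Local Open Scope ring_scope.
Local Open Scope classical_set_scope.
Context {C : abelianCategory}.
Implicit Types X Y Z : C.

Lemma zero_exists : exists Z : C, is_zero_object Z.
Proof. by have [] := ab_abelian C. Qed.

Lemma biproduct_exists X Y : exists S : C, is_biproduct X Y S.
Proof. by have [_ + _ _ _] := ab_abelian C; apply. Qed.

Lemma kernel_exists X Y (f : hom X Y) :
  exists (K : C) (k : hom K X), is_kernel k f.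
Proof. by have [_ _ /(_ _ _ f)[]] := ab_abelian C. Qed.

Lemma cokernel_exists X Y (f : hom X Y) :
  exists (Q : C) (q : hom Y Q), is_cokernel q f.
Proof. by have [_ _ /(_ _ _ f)[]] := ab_abelian C. Qed.

(** A mono is the kernel of some [g]; as [g] factors through the cokernel of
    the mono, the latter has the same kernel. *)
Lemma mono_short_exact X Y Q (f : hom X Y) (q : hom Y Q) :
  is_mono f -> is_cokernel q f -> short_exact f q.
Proof.
move=> mf qf; split=> //; have [qf0 qU] := qf.
have [_ _ _ + _] := ab_abelian C; case/(_ _ _ _ mf) => [Z [g [gf0 fU]]].
apply: kernelI => // W h qh0; have [u [ug _]] := qU _ g gf0.
have [|v [fv _]] := fU _ h; last by exists v.
by rewrite -ug -comp_assoc qh0 compm0.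
Qed.

Lemma kernel_of_epi_exact K X Y (k : hom K X) (f : hom X Y) :
  is_epi f -> is_kernel k f -> short_exact k f.
Proof.
move=> ef kf; split=> //; have [fk0 kU] := kf.
have [_ _ _ _ +] := ab_abelian C; case/(_ _ _ _ ef) => [Z [g [fg0 fU]]].
apply: cokernelI => // W h hk0; have [u [ku _]] := kU _ g fg0.
have [|v [vf _]] := fU _ h; last by exists v.
by rewrite -ku comp_assoc hk0 comp0m.
Qed.

Lemma epi_cokernel_zero X Y Q (f : hom X Y) (q : hom Y Q) :
  is_cokernel q f -> is_zero_object Q -> is_epi f.
Proof.
move=> [_ qU] Q0; apply: epi0 => W g /qU[h [<- _]].
by have [/(_ h) -> _] := Q0 W; rewrite comp0m.
Qed.

(** A retract is a summand, the complement being the kernel of the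
    retraction. *)
Lemma retract_direct_summand X Y : retract X Y -> direct_summand X Y.
Proof.
move=> [i [p pi]]; have [K [k kp]] := kernel_exists p.
have mk := kernel_mono kp; have [pk0 kU] := kp.
have [|q [kq _]] := kU _ (idm Y - i \oc p).
  by rewrite compmB comp_assoc pi comp_idl comp_idr subrr.
exists K, i, k, p, q; split=> //.
- by apply: mk; rewrite comp_assoc kq compBm -comp_assoc pk0 compm0 subr0 comp_idl comp_idr.
- by apply: (mono_eq0 mk); rewrite comp_assoc kq compBm -comp_assoc pi comp_idl comp_idr subrr.
- by rewrite kq addrC subrK.
Qed.

(** Epimorphisms are stable under base change. The pullback is the kernel of
    [(v, -t)] on the biproduct of the sources; as this map is itself an
    epimorphism, it is the cokernel of the pullback. *)
Lemma pullback_epi X Y T (v : hom X Y) (t : hom T Y) : is_epi v ->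
  exists (P : C) (s : hom P X) (r : hom P T), v \oc s = t \oc r /\ is_epi r.
Proof.
move=> ev; have [S [iX [iT [pX [pT [Xi Ti XT TX S1]]]]]] := biproduct_exists X T.
pose w := v \oc pX - t \oc pT.
have wX : w \oc iX = v.
  by rewrite compBm -!comp_assoc Xi TX compm0 comp_idr subr0.
have wT : w \oc iT = - t.
  by rewrite compBm -!comp_assoc Ti XT compm0 comp_idr sub0r.
have ew : is_epi w by apply: (@epi_of_comp _ _ _ _ _ iX); rewrite wX.
have [P [k kw]] := kernel_exists w.
have [_ [wk0 wU]] := kernel_of_epi_exact ew kw.
exists P, (pX \oc k), (pT \oc k); split.
  by apply/subr0_eq; rewrite !comp_assoc -compBm.
apply: epi0 => W a; rewrite comp_assoc => /wU[b [bw _]].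
have b0 : b = 0.
  by apply: (epi_eq0 ev); rewrite -wX comp_assoc bw -comp_assoc TX compm0.
by rewrite -(comp_idr a) -Ti comp_assoc -bw b0 !comp0m.
Qed.

(** The third isomorphism theorem, [(F / U) / (E / U) = F / E]. All maps come
    from universal properties; the substance is that [E / U -> F / U] is mono,
    where [pullback_epi] stands in for a choice of preimages along [v]. *)
Lemma third_isomorphism (U E F V W : C) (u : hom U E) (v : hom E V)
    (e : hom E F) (x : hom F W) :
  short_exact u v -> short_exact e x ->
  exists (Y : C) (c : hom F Y) (w : hom V Y) (y : hom Y W),
    short_exact (e \oc u) c /\ short_exact w y.
Proof.
move=> [ku cv] [ke cx]; have [mu me] := (kernel_mono ku, kernel_mono ke).
have [ev ex] := (cokernel_epi cv, cokernel_epi cx).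
have [Y [c cc]] := cokernel_exists (e \oc u); have ec := cokernel_epi cc.
have seq1 := mono_short_exact (mono_comp me mu) cc.
have [[ceu0 kerc] _] := seq1; have [_ cU] := cc.
have [vu0 vU] := cv; have [xe0 xU] := cx.
have [|w [wv _]] := vU _ (c \oc e); first by rewrite -comp_assoc.
have [|y [yc _]] := cU _ x; first by rewrite comp_assoc xe0 comp0m.
exists Y, c, w, y; split=> //.
apply: mono_short_exact.
  (* A [t] with [w t = 0] is lifted along [v] after base change: the lift maps
     into the kernel of [c], that is into [U], so [t] vanishes on an epi. *)
  apply: mono0 => T t wt0; have [P [s [r [vs er]]]] := pullback_epi t ev.
  apply: (epi_eq0 er); rewrite -vs.
  have [|a [eua _]] := kerc _ (e \oc s).
    by rewrite comp_assoc -wv -comp_assoc vs comp_assoc wt0 comp0m.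
  have <- : u \oc a = s by apply: me; rewrite comp_assoc.
  by rewrite comp_assoc vu0 comp0m.
apply: cokernelI.
- by apply: (epi_eq0 ev); rewrite -comp_assoc wv comp_assoc yc.
- by apply: (@epi_of_comp _ _ _ _ _ c); rewrite yc.
- move=> Z g gw0; have [|h [hx _]] := xU _ (g \oc c).
    by rewrite -comp_assoc -wv comp_assoc gw0 comp0m.
  by exists h; apply: ec; rewrite -comp_assoc yc.
Qed.

End Abelian.

(** * Additive closures and extensions *)

Section BiproductOfExactSequences.
Local Open Scope ring_scope.
Local Open Scope classical_set_scope.

(** The biproduct identities with the structure maps exposed, so that a single
    map of biproducts can be shown to be both a kernel and, in the opposite
    category, a cokernel. *)
Definition biproduct_maps (C : preadditive) (X Y S : C) (iX : hom X S)
    (iY : hom Y S) (pX : hom S X) (pY : hom S Y) : Prop :=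
  [/\ pX \oc iX = idm X, pY \oc iY = idm Y, pX \oc iY = 0, pY \oc iX = 0 &
      iX \oc pX + iY \oc pY = idm S].

Lemma biproduct_kernel (C : preadditive) (X1 Y1 S1 X Y S X2 Y2 S2 : C)
    (iX1 : hom X1 S1) (iY1 : hom Y1 S1) (pX1 : hom S1 X1) (pY1 : hom S1 Y1)
    (iX : hom X S) (iY : hom Y S) (pX : hom S X) (pY : hom S Y)
    (iX2 : hom X2 S2) (iY2 : hom Y2 S2) (pX2 : hom S2 X2) (pY2 : hom S2 Y2)
    (f : hom X1 X) (f' : hom Y1 Y) (g : hom X X2) (g' : hom Y Y2) :
  biproduct_maps iX1 iY1 pX1 pY1 -> biproduct_maps iX iY pX pY ->
  biproduct_maps iX2 iY2 pX2 pY2 ->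
  is_kernel f g -> is_kernel f' g' ->
  is_kernel (iX \oc (f \oc pX1) + iY \oc (f' \oc pY1))
            (iX2 \oc (g \oc pX) + iY2 \oc (g' \oc pY)).
Proof.
move=> [xx1 yy1 xy1 yx1 s1] [xx yy xy yx s] [xx2 yy2 xy2 yx2 s2] kf kf'.
have [mf mf'] := (kernel_mono kf, kernel_mono kf').
have [[gf0 fU] [gf0' fU']] := (kf, kf').
set a := _ + _; set b := _ + _.
have aX : pX \oc a = f \oc pX1.
  by rewrite comp_addr !(comp_assoc pX) xx xy comp_idl comp0m addr0.
have aY : pY \oc a = f' \oc pY1.
  by rewrite comp_addr !(comp_assoc pY) yy yx comp_idl comp0m add0r.
have bX : pX2 \oc b = g \oc pX.
  by rewrite comp_addr !(comp_assoc pX2) xx2 xy2 comp_idl comp0m addr0.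
have bY : pY2 \oc b = g' \oc pY.
  by rewrite comp_addr !(comp_assoc pY2) yy2 yx2 comp_idl comp0m add0r.
apply: kernelI.
- rewrite comp_addl -!comp_assoc aX aY.
  by rewrite (comp_assoc g) gf0 (comp_assoc g') gf0' !comp0m !compm0 addr0.
- apply: mono0 => W t at0.
  have tX : pX1 \oc t = 0.
    by apply: (mono_eq0 mf); rewrite comp_assoc -aX -comp_assoc at0 compm0.
  have tY : pY1 \oc t = 0.
    by apply: (mono_eq0 mf'); rewrite comp_assoc -aY -comp_assoc at0 compm0.
  by rewrite -(comp_idl t) -s1 comp_addl -!comp_assoc tX tY !compm0 addr0.
- move=> W h bh0.
  have [|u [fu _]] := fU _ (pX \oc h).
    by rewrite comp_assoc -bX -comp_assoc bh0 compm0.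
  have [|u' [fu' _]] := fU' _ (pY \oc h).
    by rewrite comp_assoc -bY -comp_assoc bh0 compm0.
  exists (iX1 \oc u + iY1 \oc u').
  rewrite -[RHS]comp_idl -s comp_addl -!comp_assoc -fu -fu' comp_addl !comp_addr.
  rewrite -!comp_assoc !(comp_assoc pX1) !(comp_assoc pY1) xx1 yy1 xy1 yx1.
  by rewrite !comp_idl !comp0m !compm0 addr0 add0r.
Qed.

Lemma biproduct_short_exact (C : preadditive) (X1 Y1 S1 X Y S X2 Y2 S2 : C)
    (f : hom X1 X) (g : hom X X2) (f' : hom Y1 Y) (g' : hom Y Y2) :
  is_biproduct X1 Y1 S1 -> is_biproduct X Y S -> is_biproduct X2 Y2 S2 ->
  short_exact f g -> short_exact f' g' ->
  exists (a : hom S1 S) (b : hom S S2), short_exact a b.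
Proof.
move=> [iX1 [iY1 [pX1 [pY1 b1]]]] [iX [iY [pX [pY b]]]].
move=> [iX2 [iY2 [pX2 [pY2 b2]]]] [kf cg] [kf' cg'].
exists (iX \oc (f \oc pX1) + iY \oc (f' \oc pY1)).
exists (iX2 \oc (g \oc pX) + iY2 \oc (g' \oc pY)).
split; first exact: (biproduct_kernel b1 b b2 kf kf').
have opb (U V T : C) (iU : hom U T) (iV : hom V T) pU pV :
    biproduct_maps iU iV pU pV -> @biproduct_maps (op C) U V T pU pV iU iV.
  by case.
have := @biproduct_kernel (op C) _ _ _ _ _ _ _ _ _ _ _ _ _ _ _ _ _ _ _ _ _
  _ _ _ _ (opb _ _ _ _ _ _ _ b2) (opb _ _ _ _ _ _ _ b) (opb _ _ _ _ _ _ _ b1)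
  cg cg'.
by rewrite /= !comp_assoc.
Qed.

End BiproductOfExactSequences.

Section AdditiveClosure.
Local Open Scope ring_scope.
Local Open Scope classical_set_scope.
Context {C : abelianCategory}.
Implicit Types (U V : set C) (X Y S T : C).

(** Families over any finite type may be used instead of families over
    ordinals, which makes the disjoint union of two families available without
    casts. *)
Lemma direct_sum_finType (I : finType) (D : I -> C) S
    (i : forall k, hom (D k) S) (p : forall k, hom S (D k)) :
  (forall k, p k \oc i k = idm (D k)) ->
  (forall k l, k != l -> p l \oc i k = 0) ->
  \sum_k i k \oc p k = idm S ->
  is_direct_sum (fun k : 'I_#|I| => D (enum_val k)) S.
Proof.
move=> pi pi0 s1; exists (fun k => i (enum_val k)), (fun k => p (enum_val k)).
split=> [k|k l kl|]; first exact: pi.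
  by apply: pi0; rewrite (inj_eq enum_val_inj).
by rewrite -s1 [RHS](big_enum_val (A := I)) /=; apply: eq_bigl.
Qed.

(** The middle object [B] is assembled from the [D k] by successive binary
    biproducts. When the sum is an identity, it makes [X = Y] a retract of [B]. *)
Lemma sum_factors U X Y (n : nat) (D : 'I_n -> C) (i : forall k, hom (D k) Y)
    (p : forall k, hom X (D k)) :
  additive_class U -> (forall k, U (D k)) ->
  exists (B : C) (a : hom B Y) (b : hom X B),
    U B /\ a \oc b = \sum_k i k \oc p k.
Proof.
move=> [U0 Ubip _]; elim: n D i p => [|n IHn] D i p UD.
  have [Z Z0] := @zero_exists C; exists Z, 0, 0.
  by rewrite big_ord0 compm0; split=> //; apply: U0.
have [B [a [b [UB ab]]]] :=
  IHn _ (fun k => i (lift ord0 k)) (fun k => p (lift ord0 k))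
      (fun k => UD (lift ord0 k)).
have [S DBS] := biproduct_exists (D ord0) B.
have [iX [iY [pX [pY [xx yy xy yx _]]]]] := DBS.
exists S, (i ord0 \oc pX + a \oc pY), (iX \oc p ord0 + iY \oc b).
split; first exact: (Ubip _ _ _ DBS).
rewrite big_ord_recl -ab comp_addl !comp_addr -!comp_assoc.
rewrite !(comp_assoc pX) !(comp_assoc pY) xx yy xy yx.
by rewrite !comp_idl !comp0m !compm0 addr0 add0r.
Qed.

(** Writing the identity of a direct sum as the sum of its projectors shows that
    it is a retract of an object of [V]. *)
Lemma add_least U V : additive_class V -> U `<=` V -> add U `<=` V.
Proof.
move=> Vadd UV X [n [D [S [UD [i [p [_ _ s1]]]] /direct_summand_retract XS]]].
have [B [a [b [VB ab]]]] := sum_factors i p Vadd (fun k => UV _ (UD k)).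
have [_ _ Vret] := Vadd; apply: Vret VB; apply: retract_trans XS _.
by exists b, a; rewrite ab s1.
Qed.

Lemma add_additive U : additive_class (add U).
Proof.
split=> [Z /zero_objectP Z0|X Y S XYS|X Y XY]; last first.
- move=> [n [D [S [UD DS /direct_summand_retract YS]]]].
  exists n, D, S; split=> //; apply: retract_direct_summand.
  exact: retract_trans YS.
- move=> [n1 [D1 [S1 [UD1 [i1 [p1 [a1 b1 c1]]] /direct_summand_retract XS1]]]].
  move=> [n2 [D2 [S2 [UD2 [i2 [p2 [a2 b2 c2]]] /direct_summand_retract YS2]]]].
  have [T S12T] := biproduct_exists S1 S2.
  have ST := biproduct_retract XYS S12T XS1 YS2.
  have [iX [iY [pX [pY [xx yy xy yx s]]]]] := S12T.
  pose D (z : 'I_n1 + 'I_n2) := match z with inl k => D1 k | inr k => D2 k end.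
  pose i z : hom (D z) T :=
    match z with inl k => iX \oc i1 k | inr k => iY \oc i2 k end.
  pose p z : hom T (D z) :=
    match z with inl k => p1 k \oc pX | inr k => p2 k \oc pY end.
  exists #|{: 'I_n1 + 'I_n2}|, (fun k => D (enum_val k)), T; split.
  + by move=> k; case: (enum_val k) => l /=.
  + apply: (@direct_sum_finType _ D T i p).
    * case=> k /=; rewrite -comp_assoc (comp_assoc _ _ (_ k)).
        by rewrite xx comp_idl a1.
      by rewrite yy comp_idl a2.
    * case=> k [] l kl /=; rewrite -comp_assoc (comp_assoc _ _ (_ k)).
      - by rewrite xx comp_idl b1.
      - by rewrite yx comp0m compm0.
      - by rewrite xy comp0m compm0.
      - by rewrite yy comp_idl b2.
    * rewrite big_sumType /= -s; congr (_ + _).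
        transitivity (iX \oc (idm S1 \oc pX)); last by rewrite comp_idl.
        rewrite -c1 comp_suml comp_sumr.
        by apply: eq_bigr => k _; rewrite !comp_assoc.
      transitivity (iY \oc (idm S2 \oc pY)); last by rewrite comp_idl.
      rewrite -c2 comp_suml comp_sumr.
      by apply: eq_bigr => k _; rewrite !comp_assoc.
  + exact: retract_direct_summand.
- exists 0%N, (fun _ => Z), Z; split=> //; first by case.
    exists (fun _ => 0), (fun _ => 0).
    by split=> [[]|[]|] //; rewrite big_ord0 Z0.
  by apply: retract_direct_summand; apply: retract_refl.
Qed.

Lemma sub_add U : U `<=` add U.
Proof.
move=> X UX; exists 1%N, (fun _ => X), X; split=> //.
  exists (fun _ => idm X), (fun _ => idm X).
  split=> [k|k l|]; rewrite ?comp_idl //; first by rewrite !ord1.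
  by rewrite big_ord1.
by apply: retract_direct_summand; apply: retract_refl.
Qed.

Lemma add_mono U V : U `<=` V -> add U `<=` add V.
Proof.
move=> UV; apply: add_least (add_additive V) _.
exact: subset_trans UV (@sub_add V).
Qed.

Definition extensions U V : set C := [set X |
  exists (X1 X2 : C) (f : hom X1 X) (g : hom X X2),
    [/\ U X1, V X2 & short_exact f g]].

Lemma diamondE U V : diamond U V = add (extensions U V).
Proof. by []. Qed.

Lemma zero_short_exact X Z : is_zero_object Z -> short_exact (idm X) (0 : hom X Z).
Proof.
move=> Z0; split.
  apply: kernelI; first by rewrite comp0m.
    by move=> W g h; rewrite !comp_idl.
  by move=> W g _; exists g; rewrite comp_idl.
apply: cokernelI; first by rewrite comp0m.
  by move=> W g h _; have [a _] := Z0 W; rewrite (a g) (a h).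
by move=> W g; rewrite comp_idr => ->; exists 0; rewrite comp0m.
Qed.

(** Biproducts of extensions are extensions, so the retracts of extensions
    already form an additive class. *)
Lemma diamondP U V X : additive_class U -> additive_class V ->
  diamond U V X <-> exists2 E, extensions U V E & retract X E.
Proof.
move=> [U0 Ubip _] [V0 Vbip _]; rewrite diamondE; split; last first.
  move=> [E UVE XE]; have [_ _ ret] := add_additive (extensions U V).
  by apply: ret XE _; apply: sub_add.
apply: (add_least (V := [set X | exists2 E, extensions U V E & retract X E])).
  split=> [Z Z0|Y Y' S YYS|Y Y' YY] /=.
  - exists Z; last exact: retract_refl.
    by exists Z, Z, (idm Z), 0; split; [exact: U0|exact: V0|exact: zero_short_exact].
  - move=> [E [X1 [X2 [f [g [UX1 VX2 fg]]]]] YE].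
    move=> [E' [X1' [X2' [f' [g' [UX1' VX2' fg']]]]] YE'].
    have [T EET] := biproduct_exists E E'.
    have [T1 XT1] := biproduct_exists X1 X1'.
    have [T2 XT2] := biproduct_exists X2 X2'.
    have [a [b ab]] := biproduct_short_exact XT1 EET XT2 fg fg'.
    exists T; last exact: biproduct_retract EET YE YE'.
    exists T1, T2, a, b; split=> //; first exact: Ubip XT1 UX1 UX1'.
    exact: Vbip XT2 VX2 VX2'.
  - by move=> [E UVE YE]; exists E => //; apply: retract_trans YE.
by move=> E UVE; exists E => //; apply: retract_refl.
Qed.

Lemma gen_additive T n : additive_class (gen T n).
Proof.
case: n => [|[|n]]; last 2 first.
- exact: add_additive.
- exact: add_additive.
split=> // [X Y S XYS X0 Y0|X Y XY Y0] /=.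
  exact: retract_zero X0 (biproduct_retract XYS (biproduct_zero X X0)
                            (retract_refl X) (zero_retract X0 Y0)).
exact: retract_zero XY.
Qed.

Lemma genSS T n : gen T n.+2 = diamond (add [set T]) (gen T n.+1).
Proof. by []. Qed.

Lemma gen_sub T W n : retract T W -> gen T n `<=` gen W n.
Proof.
move=> TW; have TWadd : add [set T] `<=` add [set W].
  have Wadd := add_additive [set W]; apply: add_least => // _ ->.
  by have [_ _ ret] := Wadd; apply: ret TW _; apply: sub_add.
case: n => [|n]; first by [].
elim: n => [//|n IHn]; rewrite !genSS; apply: add_mono.
move=> X [X1 [X2 [f [g [TX1 TX2 fg]]]]].
by exists X1, X2, f, g; split=> //; [exact: TWadd|exact: IHn].
Qed.

(** The half of the associativity of [diamond] that controls dimensions. By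
    [diamondP], [X1] is a summand of some [E] having a subobject [U] in [add T]
    whose quotient [V] takes one step less. Adding the complementary summand
    to [X] as well makes [E] itself the left-hand end of the sequence. Then
    [X / U] is an extension of [X2] by [V], to which induction applies. *)
Lemma gen_extension T (a b : nat) (X1 X X2 : C) (f : hom X1 X) (g : hom X X2) :
  gen T a.+1 X1 -> gen T b.+1 X2 -> short_exact f g -> gen T (a + b).+2 X.
Proof.
elim: a X1 X X2 f g => [|a IHa] X1 X X2 f g TX1 TX2 fg.
  by apply: sub_add; exists X1, X2, f, g.
have addT := add_additive [set T].
move: TX1; rewrite genSS => /diamondP[//||E [U [V [u [v [TU TV uv]]]]]].
  exact: gen_additive.
move=> /retract_direct_summand[X1' X1E].
have [F XF] := biproduct_exists X X1'; have [Z Z0] := @zero_exists C.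
have [e [x ex]] := biproduct_short_exact X1E XF (biproduct_zero X2 Z0) fg
  (zero_short_exact X1' Z0).
have [Y [c [w [y [uc wy]]]]] := third_isomorphism uv ex.
have TY := IHa _ _ _ _ _ TV TX2 wy.
rewrite addSn genSS; apply/diamondP => //; first exact: gen_additive.
exists F; first by exists U, Y, (e \oc u), c.
exact: biproduct_retractl XF.
Qed.

End AdditiveClosure.

Section ExactFunctorGen.
Local Open Scope ring_scope.
Local Open Scope classical_set_scope.
Context {C D : abelianCategory} (F : additiveFunctor C D).

Lemma functor_retract (X Y : C) : retract X Y -> retract (F X) (F Y).
Proof.
by move=> [i [p pi]]; exists (fmap F i), (fmap F p); rewrite -fmap_comp pi fmap_id.
Qed.

Lemma functor_biproduct (X Y S : C) :
  is_biproduct X Y S -> is_biproduct (F X) (F Y) (F S).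
Proof.
move=> [iX [iY [pX [pY [xx yy xy yx s]]]]].
exists (fmap F iX), (fmap F iY), (fmap F pX), (fmap F pY).
by split; rewrite -!fmap_comp ?xx ?yy ?xy ?yx ?fmap_id ?raddf0 // -raddfD s fmap_id.
Qed.

Lemma functor_zero (X : C) : is_zero_object X -> is_zero_object (F X).
Proof. by move=> /zero_objectP X0; apply/zero_objectP; rewrite -fmap_id X0 raddf0. Qed.

Lemma preimage_additive (U : set D) :
  additive_class U -> additive_class (F @^-1` U).
Proof.
move=> [U0 Ubip Uret]; split=> [Z Z0|X Y S XYS|X Y XY] /=.
- by apply: U0; apply: functor_zero.
- by apply: Ubip; apply: functor_biproduct.
- by apply: Uret; apply: functor_retract.
Qed.

Lemma exact_functor_gen (T : C) (n : nat) :
  exact_functor F -> gen T n `<=` F @^-1` gen (F T) n.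
Proof.
move=> eF; have addF : add [set T] `<=` F @^-1` add [set F T].
  apply: add_least; first exact/preimage_additive/add_additive.
  by move=> _ ->; apply: sub_add.
case: n => [|n]; first by move=> X; apply: functor_zero.
elim: n => [//|n IHn]; rewrite !genSS.
apply: add_least; first exact/preimage_additive/add_additive.
move=> X [X1 [X2 [f [g [TX1 TX2 fg]]]]]; apply: sub_add.
exists (F X1), (F X2), (fmap F f), (fmap F g).
by split; [exact: addF|exact: IHn|exact: eF].
Qed.

End ExactFunctorGen.

(** * Recollements *)

Section Recollement.
Local Open Scope ring_scope.
Local Open Scope classical_set_scope.
Context {A B C : abelianCategory}.

Lemma op_image_kernel (R : recollement A B C) :
  functor_image (op_functor (i_lstar R)) = functor_kernel (op_functor (j_ustar R)).
Proof.
have /seteqP[im_ker ker_im] := recollement_im_ker R.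
apply/seteqP; split=> Y.
  by move=> [X XY]; apply/op_zero/im_ker; exists X; apply/op_isomorphic.
by move=> /op_zero/ker_im[X XY]; exists X; apply/op_isomorphic.
Qed.

(** Taking opposites turns left adjoints into right adjoints; this is why
    [i^*] and [i^!], and likewise [j_!] and [j_*], trade places. *)
Definition op_recollement (R : recollement A B C) :
    recollement (op_abelian A) (op_abelian B) (op_abelian C) :=
  @Recollement (op_abelian A) (op_abelian B) (op_abelian C)
    (op_functor (i_lstar R)) (op_functor (i_ushriek R))
    (op_functor (i_ustar R)) (op_functor (j_ustar R))
    (op_functor (j_lstar R)) (op_functor (j_lshriek R))
    (op_adjoint (i_lstar_ushriek_adj R)) (op_adjoint (i_ustar_lstar_adj R))
    (op_adjoint (j_ustar_lstar_adj R)) (op_adjoint (j_lshriek_ustar_adj R))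
    (op_fully_faithful (i_lstar_ff R)) (op_fully_faithful (j_lstar_ff R))
    (op_fully_faithful (j_lshriek_ff R)) (op_image_kernel R).

Lemma i_lstar_exact (R : recollement A B C) : exact_functor (i_lstar R).
Proof. exact: exact_of_adjoints (i_ustar_lstar_adj R) (i_lstar_ushriek_adj R). Qed.

Lemma j_ustar_exact (R : recollement A B C) : exact_functor (j_ustar R).
Proof. exact: exact_of_adjoints (j_lshriek_ustar_adj R) (j_ustar_lstar_adj R). Qed.

(** Two adjunctions identify [Hom(X, i^! j_* Z)] with [Hom(j^* i_* X, Z)], and
    [j^* i_* = 0]. *)
Lemma i_ushriek_j_lstar (R : recollement A B C) (Z : C) :
  is_zero_object (i_ushriek R (j_lstar R Z)).
Proof.
set X := i_ushriek R _.
have [phi [psi [phiK psiK _ _]]] := adjoint_transposes (i_lstar_ushriek_adj R).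
have [phi' [psi' [phiK' psiK' _ _]]] := adjoint_transposes (j_ustar_lstar_adj R).
apply/zero_objectP; apply: (can_inj (psiK _ _)); apply: (can_inj (psiK' _ _)).
have /seteqP[im_ker _] := recollement_im_ker R.
have iX0 : is_zero_object (j_ustar R (i_lstar R X)).
  by apply: im_ker; exists X, (idm _), (idm _); rewrite comp_idl.
by have [f0 _] := iX0 Z; apply: etrans (f0 _) (esym (f0 _)).
Qed.

(** An object killed by [j^*] is some [i_* X], and an isomorphism [i_* X -> Q]
    corresponds to a morphism [X -> i^! Q]. *)
Lemma i_lstar_zero (R : recollement A B C) (Q : B) :
  is_zero_object (j_ustar R Q) -> is_zero_object (i_ushriek R Q) ->
  is_zero_object Q.
Proof.
have /seteqP[_ ker_im] := recollement_im_ker R.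
move=> /ker_im[X XQ] iQ0.
have [phi [psi [phiK _ _ _]]] := adjoint_transposes (i_lstar_ushriek_adj R).
case: XQ => f [g _ fg]; apply/zero_objectP; rewrite -fg.
suff -> : f = 0 by rewrite comp0m.
apply: (can_inj (phiK _ _)); have [_ h0] := iQ0 X.
by apply: etrans (h0 _) (esym (h0 _)).
Qed.

(** If [Q] is the cokernel of [f], then [j^* Q = 0] because [j^* f] is epi, and
    [i^! Q = 0] because the exact functor [i^!] makes it a quotient of
    [i^! j_* Z = 0]; so [Q = 0]. *)
Lemma epi_to_j_lstar (R : recollement A B C) (X : B) (Z : C)
    (f : hom X (j_lstar R Z)) :
  exact_functor (i_ushriek R) -> is_epi (fmap (j_ustar R) f) -> is_epi f.
Proof.
move=> ei ejf; have [Q [q qf]] := cokernel_exists f.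
have eq := cokernel_epi qf; apply: (epi_cokernel_zero qf).
have [K [k kq]] := kernel_exists q.
have kqE := kernel_of_epi_exact eq kq.
have ejq := cokernel_epi (j_ustar_exact R kqE).2.
have eiq := cokernel_epi (ei _ _ _ _ _ kqE).2.
apply: i_lstar_zero; apply/zero_objectP.
  apply: (epi_eq0 ejq); apply: (epi_eq0 ejf).
  by rewrite comp_idl -fmap_comp (proj1 qf) raddf0.
apply: (epi_eq0 eiq); have [h0 _] := i_ushriek_j_lstar R Z (i_ushriek R Q).
exact: h0.
Qed.

Lemma j_lstar_exact (R : recollement A B C) :
  exact_functor (i_ushriek R) -> exact_functor (j_lstar R).
Proof.
move=> ei X Y Z f g [kf cg].
apply: kernel_of_epi_exact; last exact: right_adjoint_kernel (j_ustar_lstar_adj R) kf.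
apply: (epi_to_j_lstar ei).
have [_ [eps [isoeps _ nat]]] := counit_iso (j_ustar_lstar_adj R) (j_lstar_ff R).
have [u ueps epsu] := isoeps Z.
rewrite -[fmap _ _]comp_idl -ueps -comp_assoc -nat comp_assoc.
apply: epi_comp (iso_epi (isoeps Y)); apply: epi_comp (cokernel_epi cg).
by apply: iso_epi; exists (eps Z).
Qed.

(** The unit [X -> j_* j^* X] becomes invertible under [j^*]. It is therefore
    epi by [epi_to_j_lstar], and [j^*] kills its kernel, which thus lies in the
    image of [i_*]. *)
Lemma ushriek_exact_sequence (R : recollement A B C) (X : B) :
  exact_functor (i_ushriek R) ->
  exists (Y : A) (K : B) (k : hom K X) (e : hom X (j_lstar R (j_ustar R X))),
    isomorphic (i_lstar R Y) K /\ short_exact k e.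
Proof.
move=> ei.
have [eta [_ [_ isoeta _]]] := counit_iso (j_ustar_lstar_adj R) (j_lstar_ff R).
have [K [k kk]] := kernel_exists (eta X).
have ke : short_exact k (eta X).
  apply: kernel_of_epi_exact => //; apply: (epi_to_j_lstar ei).
  exact: iso_epi.
have mjk := kernel_mono (j_ustar_exact R ke).1.
have jk0 : fmap (j_ustar R) k = 0.
  have [u ue eu] := isoeta X; rewrite -[LHS]comp_idl -ue -comp_assoc -fmap_comp.
  by rewrite (proj1 kk) raddf0 compm0.
have /seteqP[_ ker_im] := recollement_im_ker R.
have [|Y YK] := ker_im K.
  by apply/zero_objectP; apply: (mono_eq0 mjk); rewrite jk0 comp0m.
by exists Y, K, k, (eta X).
Qed.

End Recollement.

Section RecollementDimension.
Local Open Scope ring_scope.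
Local Open Scope classical_set_scope.
Context {A B C : abelianCategory}.

Lemma lshriek_exact (R : recollement A B C) :
  exact_functor (i_ustar R) -> exact_functor (j_lshriek R).
Proof.
move=> /op_exact_functor ei; apply/op_exact_functor.
exact: (@j_lstar_exact _ _ _ (op_recollement R)).
Qed.

Lemma ustar_exact_sequence (R : recollement A B C) (X : B) :
  exact_functor (i_ustar R) ->
  exists (Y : A) (K : B) (e : hom (j_lshriek R (j_ustar R X)) X) (k : hom X K),
    isomorphic (i_lstar R Y) K /\ short_exact e k.
Proof.
move=> /op_exact_functor ei.
have [Y [K [k [e [YK ke]]]]] := @ushriek_exact_sequence _ _ _ (op_recollement R) X ei.
by exists Y, K, e, k; split; [exact/op_isomorphic|exact/op_short_exact].
Qed.

Lemma gen_essentially_surjective (D E : abelianCategory) (F : additiveFunctor D E)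
    (n : nat) (T : D) :
  exact_functor F -> (forall Y, exists X, isomorphic (F X) Y) ->
  gen T n = [set: D] -> gen (F T) n = [set: E].
Proof.
move=> eF surjF TD; apply/seteqP; split=> // Y _.
have [X /isomorphic_sym/retract_iso XY] := surjF Y.
have [_ _ ret] := gen_additive (F T) n; apply: ret XY _.
by apply: exact_functor_gen => //; rewrite TD.
Qed.

Lemma gen_image (D E : abelianCategory) (F : additiveFunctor D E)
    (n : nat) (T : D) (W : E) (X : D) :
  exact_functor F -> retract (F T) W -> gen T n = [set: D] -> gen W n (F X).
Proof.
move=> eF TW TD; apply: (gen_sub TW).
by apply: exact_functor_gen => //; rewrite TD.
Qed.

(** The two cases differ in the order of the ends of the sequence, which is
    immaterial for the number of steps. *)
Lemma gen_recollement (R : recollement A B C) (n m : nat) (T : A) (S : C) :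
  exact_functor (i_ushriek R) \/ exact_functor (i_ustar R) ->
  gen T n.+1 = [set: A] -> gen S m.+1 = [set: C] ->
  exists W : B, gen W (n + m).+2 = [set: B].
Proof.
have ei := i_lstar_exact R.
case=> eF TA SC.
- have [W TSW] := biproduct_exists (i_lstar R T) (j_lstar R S).
  have TW := biproduct_retractl TSW.
  have SW := biproduct_retractl (biproduct_sym TSW).
  exists W; apply/seteqP; split=> // X _.
  have [Y [K [k [e [/isomorphic_sym/retract_iso KY ke]]]]] :=
    ushriek_exact_sequence X eF.
  have [_ _ ret] := gen_additive W n.+1.
  apply: gen_extension ke; first by apply: ret KY _; apply: gen_image TA.
  exact: gen_image (j_lstar_exact eF) SW SC.
- have [W TSW] := biproduct_exists (i_lstar R T) (j_lshriek R S).
  have TW := biproduct_retractl TSW.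
  have SW := biproduct_retractl (biproduct_sym TSW).
  exists W; apply/seteqP; split=> // X _.
  have [Y [K [e [k [/isomorphic_sym/retract_iso KY ek]]]]] :=
    ustar_exact_sequence X eF.
  have [_ _ ret] := gen_additive W n.+1; rewrite addnC.
  apply: gen_extension ek; last by apply: ret KY _; apply: gen_image TA.
  exact: gen_image (lshriek_exact eF) SW SC.
Qed.

End RecollementDimension.

(** * Extension dimensions as extended integers *)

Section ExtDim.
Local Open Scope ring_scope.
Local Open Scope classical_set_scope.
Local Open Scope ereal_scope.

(** The infimum is attained, as the set of admissible lengths consists of
    natural numbers. *)
Lemma ext_dimP (A : abelianCategory) :
  ((forall n (T : A), gen T n.+1 <> [set: A]) /\ ext_dim A = +oo) \/
  exists (n : nat) (T : A), [/\ gen T n.+1 = [set: A], ext_dim A = (n%:Z)%:E &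
    forall m (S : A), gen S m.+1 = [set: A] -> (n <= m)%N].
Proof.
pose P n := `[< exists T : A, gen T n.+1 = [set: A] >].
have [exP|noP] := pselect (exists n, P n); last first.
  left; split=> [n T TA|]; first by apply: noP; exists n; apply/asboolP; exists T.
  rewrite /ext_dim /infimum ifT //; apply/eqP; rewrite -subset0 => t [n [T TA] _].
  by apply: noP; exists n; apply/asboolP; exists T.
right; case: (ex_minnP exP) => n /asboolP[T TA] nmin; exists n, T; split=> //.
  rewrite /ext_dim /infimum; set D := image _ _.
  have Dn : D (n%:Z)%:E by exists n => //; exists T.
  rewrite ifF; last by apply/negP => /eqP D0; rewrite D0 in Dn.
  apply: xget_subset1; last exact: is_subset1_infimums.
  split=> [_ [m [S SA] <-]|l lD]; last exact: lD.
  by rewrite lee_fin lez_nat; apply: nmin; apply/asboolP; exists S.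
by move=> m S SA; apply: nmin; apply/asboolP; exists S.
Qed.

Lemma ext_dim_le (A : abelianCategory) (n : nat) (T : A) :
  gen T n.+1 = [set: A] -> ext_dim A <= (n%:Z)%:E.
Proof.
move=> TA; have [[/(_ n T)//]|[m [S [_ -> mmin]]]] := ext_dimP A.
by rewrite lee_fin lez_nat; apply: mmin TA.
Qed.

Lemma ext_dim_mono (A B : abelianCategory) (F : additiveFunctor B A) :
  exact_functor F -> (forall Y, exists X, isomorphic (F X) Y) ->
  ext_dim A <= ext_dim B.
Proof.
move=> eF surjF; have [[_ ->]|[n [T [TB -> _]]]] := ext_dimP B; first by rewrite leey.
exact: ext_dim_le (gen_essentially_surjective eF surjF TB).
Qed.

End ExtDim.

Theorem theorem5p5 (A B C : abelianCategory) (R : recollement A B C)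
    (hexact : exact_functor (i_ushriek R) \/ exact_functor (i_ustar R)) :
  (Order.max (ext_dim A) (ext_dim C) <= ext_dim B)%E /\
  (ext_dim B <= ext_dim A + ext_dim C + 1)%E.
Proof.
split.
  rewrite ge_max; apply/andP; split; last first.
    apply: ext_dim_mono (@j_ustar_exact _ _ _ R) _.
    exact: left_adjoint_essentially_surjective (j_ustar_lstar_adj R) (j_lstar_ff R).
  case: hexact => eF; apply: ext_dim_mono eF _.
    exact: right_adjoint_essentially_surjective (i_lstar_ushriek_adj R) (i_lstar_ff R).
  exact: left_adjoint_essentially_surjective (i_ustar_lstar_adj R) (i_lstar_ff R).
have [[_ ->]|[n [T [TA -> _]]]] := ext_dimP A.
  by have [[_ ->]|[m [S [_ -> _]]]] := ext_dimP C; rewrite leey.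
have [[_ ->]|[m [S [SC -> _]]]] := ext_dimP C; first by rewrite leey.
have [W WB] := gen_recollement hexact TA SC.
apply: le_trans (ext_dim_le WB) _.
rewrite -!EFinD lee_fin -addn1 !PoszD.
exact: lexx.
Qed.
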